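(* Let $q$ be a prime power and $1\le t\le k\le n$ integers, and let $\mathbb{S}$ be a $q$-Steiner system $S_q(t,k,n)$. Let $\mathbb{S}'$ be the multiset $\{B' : B\in\mathbb{S}\}$, where $B'\subseteq\mathbb{F}_q^{n-1}$ is obtained from $B$ by deleting the last coordinate of every vector. Then: (i) the members of $\mathbb{S}'$ of dimension $k-1$ are exactly $\frac{\binom{n-1}{t-1}_q}{\binom{k-1}{t-1}_q}$ pairwise distinct $(k-1)$-subspaces of $\mathbb{F}_q^{n-1}$, and the set $\tilde{\mathbb{S}}$ of these subspaces is a $q$-Steiner system $S_q(t-1,k-1,n-1)$; (ii) every $t$-dimensional subspace of $\mathbb{F}_q^{n-1}$ which is contained in some member of $\tilde{\mathbb{S}}$ is contained in none of the $k$-dimensional members of $\mathbb{S}'$; (iii) every $t$-dimensional subspace of $\mathbb{F}_q^{n-1}$ which is contained in no member of $\tilde{\mathbb{S}}$ is contained in exactly $q^t$ of the $k$-dimensional members of $\mathbb{S}'$, counted with multiplicity.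
   Context: $\mathbb{F}_q$ is the finite field with $q$ elements. A $q$-Steiner system $S_q(t,k,n)$ is a collection $\mathbb{S}$ of $k$-dimensional subspaces of $\mathbb{F}_q^n$ (blocks) such that every $t$-dimensional subspace of $\mathbb{F}_q^n$ is contained in exactly one block. The Gaussian coefficient is $\binom{n}{k}_q=\frac{(q^n-1)(q^{n-1}-1)\cdots(q^{n-k+1}-1)}{(q^k-1)(q^{k-1}-1)\cdots(q-1)}$, with $\binom{n}{0}_q=1$. *)

(* Defs.v *)
From HB Require Import structures.
From mathcomp Require Import all_boot all_order all_algebra.
From mathcomp Require Import finmap multiset.

Set Implicit Arguments.
Unset Strict Implicit.
Unset Printing Implicit Defensive.

Import GRing.Theory.

Local Open Scope fset_scope.
Local Open Scope mset_scope.
Local Open Scope ring_scope.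

(* The truncated subtraction n - i makes this vanish when n < k. *)
Definition gauss_coef (q n k : nat) : rat :=
  (\prod_(i < k) (q%:R ^+ (n - i) - 1)) / (\prod_(i < k) (q%:R ^+ (k - i) - 1)).

Definition is_qsteiner (F : finFieldType) (t k n : nat)
    (S : {fset {vspace 'rV[F]_n}}) : Prop :=
  (forall B, B \in S -> \dim B = k) /\
  (forall T : {vspace 'rV[F]_n}, \dim T = t ->
     exists! B, B \in S /\ (T <= B)%VS).

(* Keeps the columns 0, ..., n - 2, in order. *)
Definition delete_last (F : finFieldType) (n : nat) (v : 'rV[F]_n) :
    'rV[F]_n.-1 :=
  colsub (widen_ord (leq_pred n)) v.

HB.instance Definition _ (F : finFieldType) (n : nat) :=
  GRing.Linear.copy (@delete_last F n) (colsub (widen_ord (leq_pred n))).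

Definition puncture (F : finFieldType) (n : nat) (B : {vspace 'rV[F]_n}) :
    {vspace 'rV[F]_n.-1} :=
  (linfun (@delete_last F n) @: B)%VS.

Definition punctured_blocks (F : finFieldType) (n : nat)
    (S : {fset {vspace 'rV[F]_n}}) : {mset {vspace 'rV[F]_n.-1}} :=
  seq_mset [seq puncture B | B <- S].

Definition dropped_blocks (F : finFieldType) (k n : nat)
    (S : {fset {vspace 'rV[F]_n}}) : {fset {vspace 'rV[F]_n.-1}} :=
  [fset C in punctured_blocks S | \dim C == k.-1].

(* Main.v *)
(* Deleting the last coordinate is a surjective linear map p whose kernel K is a
   line, so p(B) has dimension k - 1 if K <= B and k otherwise, and the blocks
   through K correspond to their images by C |-> p^-1(C).  For a (t-1)-space T,
   p^-1(T) is a t-space through K, so it lies in a unique block: this gives the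
   derived system.  A t-space T inside two images p(B), p(B') with K <= B makes
   B' :&: p^-1(T) a space of dimension at least t inside both blocks.  If T lies
   in no p(B) with K <= B, the q^t t-spaces mapped isomorphically onto T lie each
   in one block, and distinct ones lie in distinct blocks since a common block
   would contain K.  The number of blocks of a system is found by double counting
   the free t-tuples of vectors, each of which spans a t-space. *)
Require Import Defs.
From HB Require Import structures.
From mathcomp Require Import all_boot all_order all_algebra all_field.
From mathcomp Require Import finmap multiset.
From mathcomp Require Import ring zify.

Set Implicit Arguments.
Unset Strict Implicit.
Unset Printing Implicit Defensive.

Import GRing.Theory Num.Theory.

Local Open Scope fset_scope.
Local Open Scope mset_scope.
Local Open Scope ring_scope.

(** * Double counting and free tuples *)

Lemma count_exists_unique (T : eqType) (s : seq T) (P : pred T) :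
  uniq s -> (exists! x, x \in s /\ P x) -> count P s = 1%N.
Proof.
move=> Us [x [[xs Px] x_uniq]].
have <- : count_mem x s = 1%N by rewrite count_uniq_mem // xs.
apply: eq_in_count => y ys; apply/idP/eqP => [Py | ->] //.
by rewrite (x_uniq y).
Qed.

(** Double counting of incident pairs. It serves twice with the blocks as [s]: for free tuples, and
    for the lifts of a subspace. *)
Lemma sum_card_incidence (I : finType) (A : {set I}) (J : Type) (s : seq J)
    (r : I -> J -> bool) :
  (forall i, i \in A -> count (r i) s = 1%N) ->
  (\sum_(j <- s) #|[set i in A | r i j]| = #|A|)%N.
Proof.
move=> r1; rewrite -sum1_card -(eq_bigr _ r1).
transitivity (\sum_(j <- s) \sum_(i in A) r i j)%N.
  apply: eq_bigr => j _; rewrite -sum1_card -big_mkcondr /=.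
  by apply: eq_bigl => i; rewrite inE.
rewrite exchange_big; apply: eq_bigr => i _ /=.
by rewrite -sum1_count [RHS]big_mkcond.
Qed.

(** Induction on [t]: a free tuple is a free tail [y] in [U] with a head chosen in [U] outside
    [<<y>>]. For [t > \dim U] both sides vanish, through the factor [i = \dim U]. *)
Lemma card_free_tuples (F : finFieldType) n (U : {vspace 'rV[F]_n}) t :
  #|[set x : t.-tuple 'rV[F]_n | free x & (<<x>> <= U)%VS]|
    = (\prod_(i < t) (#|F| ^ \dim U - #|F| ^ i))%N.
Proof.
elim: t => [|t IHt].
  rewrite big_ord0; apply: etrans (cards1 (nil_tuple 'rV[F]_n)).
  by apply: eq_card => x; rewrite !inE tuple0 nil_free span_nil sub0v eqxx.
rewrite big_ord_recr /= -IHt -sum_nat_const -sum1_card.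
rewrite (partition_big (fun x : t.+1.-tuple 'rV[F]_n => behead_tuple x : t.-tuple _)
  [pred y : t.-tuple _ | free y & (<<y>> <= U)%VS]) /=; last first.
  move=> x; rewrite inE; case/tupleP: x => v y /=.
  by rewrite free_cons span_cons subv_add => /andP[/andP[_ ->] /andP[_ ->]].
apply: eq_big => [y | y /andP[fy yU]]; first by rewrite inE.
rewrite sum1_card -(_ : #|[set v in U | v \notin <<y>>%VS]| =
  (#|F| ^ \dim U - #|F| ^ t)%N); last first.
  have dy : \dim <<y>> = t by rewrite (eqnP fy) size_tuple.
  rewrite -[in (_ ^ t)%N]dy -!card_vspace.
  rewrite -[X in (X - _)%N](cardID (mem <<y>>%VS)).
  rewrite [X in (X + _ - _)%N](_ : _ = #|<<y>>%VS|); last first.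
    apply: eq_card => v; rewrite !inE; apply: andb_idl.
    exact: (subvP yU).
  rewrite addKn; apply: eq_card => v; rewrite !inE; exact: andbC.
rewrite -(card_imset (f := fun v => cons_tuple v y)) => [|u v /(congr1 val)[]//].
apply: eq_card => x; apply/andP/imsetP => [[xA /eqP <-]|[v vU ->]].
  case/tupleP: x xA => v z; rewrite inE /= free_cons span_cons subv_add.
  move=> /andP[/andP[vz _] /andP[vU _]]; exists v; last exact: val_inj.
  by rewrite inE memvE vU.
move: vU; rewrite !inE /= free_cons span_cons subv_add fy yU -val_eqE /=.
by move=> /andP[vU ->]; rewrite -memvE vU eqxx.
Qed.

(** * Number of blocks of a Steiner system *)

Section Steiner.
Variables (F : finFieldType) (t k n : nat) (S : {fset {vspace 'rV[F]_n}}).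
Hypothesis hS : is_qsteiner t k S.

Lemma qsteiner_count (T : {vspace 'rV[F]_n}) :
  \dim T = t -> count (fun B => (T <= B)%VS) S = 1%N.
Proof.
case: hS => _ hT /hT; apply: (@count_exists_unique _ _ (fun B => T <= B)%VS).
exact: fset_uniq.
Qed.

(** Uniqueness passes from dimension [t] to larger ones: the first [t] vectors of a basis of [T]
    span a [t]-space inside both blocks. *)
Lemma qsteiner_unique (T B B' : {vspace 'rV[F]_n}) :
  (t <= \dim T)%N -> B \in S -> B' \in S ->
  (T <= B)%VS -> (T <= B')%VS -> B = B'.
Proof.
move=> tT BS B'S TB TB'; pose T0 := <<take t (vbasis T)>>%VS.
have T0T : (T0 <= T)%VS by apply/span_subvP => v /mem_take/vbasis_mem.
have dT0 : \dim T0 = t.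
  have := basis_free (vbasisP T); rewrite -(cat_take_drop t (vbasis T)).
  by move/catl_free/eqnP; rewrite size_takel ?size_tuple.
have [B0 [_ uB0]] := proj2 hS _ dT0.
by rewrite -(uB0 B) ?(uB0 B') //; split=> //; apply: subv_trans T0T _.
Qed.

Lemma qsteiner_card_prod :
  (#|` S| * \prod_(i < t) (#|F| ^ k - #|F| ^ i)
    = \prod_(i < t) (#|F| ^ n - #|F| ^ i))%N.
Proof.
have := card_free_tuples {:'rV[F]_n} t.
have -> : \dim {:'rV[F]_n} = n by rewrite dimvf dim_matrix [LHS]mul1n.
move=> <-; rewrite -(@sum_card_incidence _ _ _ S
  (fun (x : t.-tuple 'rV[F]_n) B => (<<x>> <= B)%VS)) => [|x]; last first.
  by rewrite inE => /andP[fx _]; rewrite qsteiner_count // (eqnP fx) size_tuple.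
rewrite -sum1_size big_distrl big_seq [RHS]big_seq.
apply: eq_bigr => B BS; rewrite [LHS]mul1n -(proj1 hS B BS) -card_free_tuples.
by apply: eq_card => x; rewrite !inE subvf andbT.
Qed.

Lemma prod_expr_sub (q m : nat) : (t <= m)%N -> (0 < q)%N ->
  (\prod_(i < t) (q ^ m - q ^ i))%:R
    = \prod_(i < t) q%:R ^+ i * \prod_(i < t) (q%:R ^+ (m - i) - 1) :> rat.
Proof.
move=> tm q0; rewrite natr_prod -big_split /=; apply: eq_bigr => i _.
have im : (i <= m)%N by apply: leq_trans tm; apply: ltnW.
by rewrite natrB ?leq_pexp2l // !natrX mulrBr mulr1 -exprD subnKC.
Qed.

(** In the product identity the powers [q ^ i] are common to both sides and cancel; the two Gaussian
    coefficients have the same denominator, which cancels in the quotient. *)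
Lemma qsteiner_card : (t <= k)%N -> (k <= n)%N ->
  (#|` S|)%:R = gauss_coef #|F| n t / gauss_coef #|F| k t.
Proof.
move=> tk kn; have q1 := finNzRing_gt1 F; have q0 := ltnW q1.
have nz m : (t <= m)%N -> \prod_(i < t) (#|F|%:R ^+ (m - i) - 1 : rat) != 0.
  move=> tm; apply/prodf_neq0 => i _; rewrite subr_eq0 -natrX pnatr_eq1.
  by rewrite -(expn0 #|F|) eqn_exp2l // subn_eq0 -ltnNge (leq_trans _ tm).
have := congr1 (fun x => x%:R : rat) qsteiner_card_prod.
rewrite natrM !prod_expr_sub ?(leq_trans tk) // /gauss_coef.
have : \prod_(i < t) (#|F|%:R ^+ i : rat) != 0.
  by apply/prodf_neq0 => i _; rewrite expf_neq0 // pnatr_eq0 -lt0n.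
move: (nz t (leqnn t)) (nz k tk) (nz n (leq_trans tk kn)).
set P := \prod_(i < t) _; set A := \prod_(i < t) _; set D := \prod_(i < t) _.
set Q := \prod_(i < t) _ => P0 A0 D0 Q0 e.
have {}e : (#|` S|)%:R * A = D by apply: (mulfI Q0); rewrite -e; ring.
by rewrite -e; field; rewrite P0 A0.
Qed.
End Steiner.

(** * Linear surjections whose kernel is a line *)

Section LineKernel.
Variables (F : fieldType) (V W : vectType F) (f : 'Hom(V, W)).
Hypotheses (f_surj : limg f = fullv) (dim_ker : \dim (lker f) = 1%N).

Lemma limg_preim (C : {vspace W}) : (f @: (f @^-1: C))%VS = C.
Proof. by rewrite lpreimK // f_surj subvf. Qed.

Lemma subv_lpreim (B : {vspace V}) (C : {vspace W}) :
  (B <= f @^-1: C)%VS = (f @: B <= C)%VS.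
Proof.
apply/idP/idP => [/(limgS f)|BC]; first by rewrite limg_preim.
by apply/subvP => v vB; rewrite -memv_preim (subvP BC) ?memv_img.
Qed.

Lemma lker_sub_lpreim (C : {vspace W}) : (lker f <= f @^-1: C)%VS.
Proof. by rewrite -lpreim0 lpreimS ?sub0v. Qed.

Lemma lpreim_limg (B : {vspace V}) :
  (lker f <= B)%VS -> (f @^-1: (f @: B))%VS = B.
Proof.
move=> KB; apply/eqP; rewrite eqEsubv subv_lpreim subvv andbT.
apply/subvP => v; rewrite -memv_preim => /memv_imgP[u uB /eqP].
rewrite -subr_eq0 -linearB -memv_ker => /(subvP KB) vuB.
by rewrite -(subrK u v) memvD.
Qed.

(** Rank-nullity: since the kernel is a line, [B] contains it or meets it in 0. The inclusion is
    read as the number 1 or 0. *)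
Lemma dim_limg_line (B : {vspace V}) :
  ((lker f <= B)%VS + \dim (f @: B) = \dim B)%N.
Proof.
rewrite -(limg_ker_dim f B); congr (_ + _)%N.
have [KB | nKB] := boolP (lker f <= B)%VS.
  by rewrite (capv_idPr KB) dim_ker.
apply/esym/eqP; rewrite -leqn0 -ltnS -dim_ker.
rewrite (ltn_leqif (dimv_leqif_sup (capvSr B (lker f)))).
by rewrite subv_cap negb_and nKB.
Qed.

Lemma dim_lpreim (C : {vspace W}) : \dim (f @^-1: C) = (\dim C).+1.
Proof. by rewrite -dim_limg_line lker_sub_lpreim limg_preim. Qed.
End LineKernel.
(** Each of the [#|F| ^ t] lifts of [T] lies in one block. Conversely, a block counted here contains
    exactly one lift and any other block none, so the incidence sum is the count. *)
Lemma count_lifts (F : finFieldType) (n t k : nat) (W : vectType F)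
    (f : 'Hom('rV[F]_n, W)) (S : {fset {vspace 'rV[F]_n}}) (T : {vspace W}) :
  limg f = fullv -> \dim (lker f) = 1%N ->
  is_qsteiner t k S -> \dim T = t ->
  (forall B, B \in S -> (lker f <= B)%VS -> ~~ (T <= f @: B)%VS) ->
  count (fun B => ~~ (lker f <= B)%VS && (T <= f @: B)%VS) S = (#|F| ^ t)%N.
Proof.
move=> f_surj dim_ker hS dT T_avoids; subst t.
pose e := vpick (lker f).
have e0 : e != 0 by rewrite vpick0 -dimv_eq0 dim_ker.
have ker_e : lker f = <[e]>%VS.
  apply/esym/eqP; rewrite eqEdim -memvE memv_pick dim_ker dim_vline.
  by rewrite e0.
have fe : f e = 0 by apply/eqP; rewrite -memv_ker memv_pick.
set t := \dim T in hS *.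
(* As c varies, U c runs over the t-spaces mapped isomorphically onto T. *)
pose g (c : 'rV[F]_t) (i : 'I_t) := f^-1%VF (vbasis T)`_i + c 0 i *: e.
pose U c := <<[seq g c i | i : 'I_t]>>%VS.
have fg c i : f (g c i) = (vbasis T)`_i.
  by rewrite /g linearD linearZ /= fe scaler0 addr0 limg_lfunVK // f_surj memvf.
have UP c (B : {vspace 'rV[F]_n}) : reflect (forall i, g c i \in B) (U c <= B)%VS.
  apply: (iffP span_subvP) => [h i | h v /imageP[i _ ->]//].
  exact/h/image_f.
have fU c : (f @: U c)%VS = T.
  rewrite limg_span -[RHS](span_basis (vbasisP T)) -map_comp.
  rewrite (eq_map (fg c)) -[X in _ = <<X>>%VS](mkseq_nth 0) size_tuple /mkseq.
  by rewrite -val_enum_ord -map_comp.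
have dU c : \dim (U c) = t.
  apply/eqP; rewrite eqn_leq; apply/andP; split.
    by rewrite (leq_trans (dim_span _)) // size_map size_enum_ord.
  by rewrite -(limg_ker_dim f) fU leq_addl.
have S1 c : c \in [set: 'rV[F]_t] -> count (fun B => (U c <= B)%VS) S = 1%N.
  by move=> _; exact: (qsteiner_count hS (dU c)).
have := sum_card_incidence S1.
rewrite cardsT card_mx mul1n => <-.
rewrite -sum1_count big_mkcond /= big_seq [RHS]big_seq; apply: eq_bigr => B BS.
case: ifPn => [/andP[nKB TB] | nQ].
  (* Two preimages of the same basis vector differ by a multiple of [e], so [x] corrects the chosen
     preimage to one in [B]. *)
  have lift (i : 'I_t) : exists x, f^-1%VF (vbasis T)`_i + x *: e \in B.
    have /(subvP TB)/memv_imgP[u uB fu] : (vbasis T)`_i \in T.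
      by rewrite vbasis_mem // mem_nth // size_tuple.
    have : u - f^-1%VF (vbasis T)`_i \in <[e]>%VS.
      rewrite -ker_e memv_ker linearB /= limg_lfunVK ?fu ?subrr //.
      by rewrite f_surj memvf.
    by case/vlineP=> x /(canRL (subrK _)) ux; exists x; rewrite addrC -ux.
  have [a aB] : exists a, forall i : 'I_t, f^-1%VF (vbasis T)`_i + a i *: e \in B.
    exact: (fin_all_exists lift).
  apply: etrans (esym (cards1 (\row_i a i))) _; apply: eq_card => c.
  rewrite !inE /=.
  apply/eqP/UP => [-> i | cB]; first by rewrite /g mxE.
  (* If [c] and [a] differed at [i], subtracting the two lifts would put a nonzero multiple of [e],
     hence the kernel, in [B]. *)
  apply/rowP => i; rewrite mxE; apply: contraNeq nKB => c_neq.
  have := memvB (cB i) (aB i).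
  rewrite /g opprD addrACA subrr add0r -scalerBl.
  move=> /(memvZ (c 0 i - a i)^-1).
  by rewrite scalerA mulVf ?subr_eq0 // scale1r memvE -ker_e.
(* An uncounted block containing a lift would have [T] in its image and contain the kernel, against
   [T_avoids]. *)
apply/esym/eqP; rewrite cards_eq0; apply/set0Pn => -[c]; rewrite !inE /= => cB.
have TB : (T <= f @: B)%VS by rewrite -(fU c) limgS.
move: nQ; rewrite TB andbT negbK => KB.
by move: (T_avoids B BS KB); rewrite TB.
Qed.

(** * Deletion of the last coordinate *)

Section Puncture.
Variables (F : finFieldType) (n : nat).
Local Notation p := (linfun (@delete_last F n.+1)).

Lemma limg_delete_last : limg p = fullv.
Proof.
apply/eqP; rewrite eqEsubv subvf; apply/subvP => w _; apply/memv_imgP.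
(* The preimage of [w] is [w] with a last coordinate 0 appended. *)
exists (\row_j if unlift ord_max j is Some i then w 0 i else 0).
  exact: memvf.
apply/rowP => i; rewrite lfunE /= !mxE.
rewrite (_ : widen_ord _ i = lift ord_max i) ?liftK //.
by apply: val_inj; rewrite [RHS]lift_max.
Qed.

Lemma dim_lker_delete_last : \dim (lker p) = 1%N.
Proof.
have := limg_ker_dim p fullv.
rewrite capfv limg_delete_last !dimvf !dim_matrix /=.
by move: (\dim _) => d; lia.
Qed.

Lemma mem_punctured_blocks (S : {fset {vspace 'rV[F]_n.+1}}) C :
  reflect (exists2 B, B \in S & C = puncture B) (C \in punctured_blocks S).
Proof.
by rewrite (perm_mem (perm_eq_seq_mset _)); apply: (iffP mapP).
Qed.

Variables (t k : nat) (S : {fset {vspace 'rV[F]_n.+1}}).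
Hypothesis hS : is_qsteiner t.+1 k.+1 S.

Lemma dim_puncture B : B \in S ->
  \dim (puncture B) = (if (lker p <= B)%VS then k else k.+1).
Proof.
move=> BS; have := dim_limg_line dim_lker_delete_last B.
by rewrite (proj1 hS B BS) /puncture; case: ifP => _ //= [].
Qed.

Lemma dim_puncture_pred B :
  B \in S -> (\dim (puncture B) == k) = (lker p <= B)%VS.
Proof. by move/dim_puncture->; case: ifP => _; lia. Qed.

Lemma dim_puncture_eq B :
  B \in S -> (\dim (puncture B) == k.+1) = ~~ (lker p <= B)%VS.
Proof. by move/dim_puncture->; case: ifP => _; lia. Qed.

Lemma mem_dropped_blocks C :
  reflect (exists B, [/\ B \in S, (lker p <= B)%VS & C = puncture B])
          (C \in dropped_blocks k.+1 S).
Proof.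
rewrite !inE /=; apply: (iffP andP).
  move=> [/mem_punctured_blocks[B BS ->]]; rewrite dim_puncture_pred // => KB.
  by exists B.
move=> [B [BS KB ->]]; rewrite dim_puncture_pred //; split=> //.
by apply/mem_punctured_blocks; exists B.
Qed.

(** The members of dimension [k] come from blocks through the kernel, and such a block is recovered
    from its image as the preimage. *)
Lemma uniq_dropped :
  uniq [seq C <- punctured_blocks S | \dim C == k].
Proof.
rewrite (perm_uniq (perm_filter _ (perm_eq_seq_mset _))) filter_map.
rewrite map_inj_in_uniq ?filter_uniq ?fset_uniq // => B B'.
rewrite !mem_filter /= => /andP[dB BS] /andP[dB' B'S] eqBB'.
rewrite !dim_puncture_pred // in dB dB'.
rewrite -(lpreim_limg limg_delete_last dB) -(lpreim_limg limg_delete_last dB').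
by congr (_ @^-1: _)%VS.
Qed.

Lemma qsteiner_dropped : is_qsteiner t k (dropped_blocks k.+1 S).
Proof.
split=> [C /mem_dropped_blocks[B [BS KB ->]]|T dT].
  by rewrite dim_puncture // KB.
have dT' : \dim (p @^-1: T) = t.+1.
  by rewrite (dim_lpreim limg_delete_last dim_lker_delete_last) dT.
have [B [[BS TB] _]] := proj2 hS _ dT'.
exists (puncture B); split.
  split; last by rewrite -(limg_preim limg_delete_last T) limgS.
  apply/mem_dropped_blocks; exists B; split=> //.
  exact: subv_trans (lker_sub_lpreim _ _) TB.
move=> _ [/mem_dropped_blocks[B' [B'S KB' ->]] TB'].
congr puncture; apply: (qsteiner_unique hS (eq_leq (esym dT'))) => //.
by rewrite -(lpreim_limg limg_delete_last KB') lpreimS.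
Qed.

Lemma size_dropped :
  size [seq C <- punctured_blocks S | \dim C == k] = #|` dropped_blocks k.+1 S|.
Proof.
apply/perm_size/uniq_perm; rewrite ?uniq_dropped ?fset_uniq // => C.
by rewrite mem_filter !inE andbC.
Qed.

(** [B' :&: p @^-1: T] maps onto [T], so its dimension is at least [t.+1]; it lies in [B'], and in
    [B] because [B] is the full preimage of its image. *)
Lemma block_through_ker_unique (T : {vspace 'rV[F]_n}) B B' :
  \dim T = t.+1 -> B \in S -> B' \in S -> (lker p <= B)%VS ->
  (T <= puncture B)%VS -> (T <= puncture B')%VS -> B' = B.
Proof.
move=> dT BS B'S KB TB TB'.
have pU : (p @: (B' :&: p @^-1: T))%VS = T.
  apply/eqP; rewrite eqEsubv -subv_lpreim ?limg_delete_last // capvSr /=.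
  apply/subvP => w wT; have /memv_imgP[u uB' wE] := subvP TB' w wT.
  by rewrite wE memv_img // memv_cap uB' -memv_preim -wE.
have TdU : (t.+1 <= \dim (B' :&: p @^-1: T))%N.
  by rewrite -dT -{1}pU -(limg_ker_dim p (_ :&: _)) leq_addl.
apply: (qsteiner_unique hS TdU) => //; first exact: capvSl.
rewrite -(lpreim_limg limg_delete_last KB).
exact: subv_trans (capvSr _ _) (lpreimS _ TB).
Qed.
End Puncture.

Theorem theorem7 (q : nat) (F : finFieldType) (hq : #|F| = q)
    (t k n : nat) (ht : (1 <= t)%N) (htk : (t <= k)%N) (hkn : (k <= n)%N)
    (S : {fset {vspace 'rV[F]_n}}) (hS : is_qsteiner t k S) :
  let S' := punctured_blocks S in
  let St := dropped_blocks k S in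
  [/\ [/\ (size [seq C <- S' | \dim C == k.-1])%:R
            = gauss_coef q n.-1 t.-1 / gauss_coef q k.-1 t.-1,
          uniq [seq C <- S' | \dim C == k.-1]
        & is_qsteiner t.-1 k.-1 St],
      (forall T : {vspace 'rV[F]_n.-1}, \dim T = t ->
         (exists2 C, C \in St & (T <= C)%VS) ->
         forall C, C \in S' -> \dim C = k -> ~~ (T <= C)%VS)
    & (forall T : {vspace 'rV[F]_n.-1}, \dim T = t ->
         (forall C, C \in St -> ~~ (T <= C)%VS) ->
         count (fun C => (\dim C == k) && (T <= C)%VS) S' = (q ^ t)%N)].
Proof.
(* The bounds make all three parameters positive; as successors, they turn the predecessors in the
   statement into variables. *)
case: t k n S => [|t] [|k] [|n] // S in ht htk hkn hS *.
move=> S' St; split.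
- split; [|exact: (uniq_dropped hS)|exact: (qsteiner_dropped hS)].
  by rewrite (size_dropped hS) (qsteiner_card (qsteiner_dropped hS)) ?hq.
- move=> T dT [_ /(mem_dropped_blocks hS)[B [BS KB ->]] TB] C.
  move=> /mem_punctured_blocks[B' B'S ->] /eqP; rewrite (dim_puncture_eq hS) //.
  (* If [T] were in the image of [B'], then [B'] would be [B], which contains the kernel, whereas an
     image of full dimension excludes this. *)
  by apply: contra => TB'; rewrite (block_through_ker_unique hS dT BS B'S KB).
- move=> T dT T_avoids.
  rewrite (permP (perm_eq_seq_mset _)) count_map -hq.
  rewrite -(count_lifts (limg_delete_last F n) (dim_lker_delete_last F n) hS dT).
    by apply: eq_in_count => B BS /=; rewrite (dim_puncture_eq hS).
  move=> B BS KB; apply: T_avoids; apply/(mem_dropped_blocks hS).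
  by exists B.
Qed.
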